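(* Let $d\ge 2$, let $\Lambda\subseteq\mathbb{R}^d$ be a well-distributed set and let $K\subseteq\mathbb{R}^d$ be a $0$-symmetric convex body. Suppose that for some $\epsilon>0$ the set $D_K(\Lambda)\cap\mathbb{R}^+$ has infinitely many gaps of length at least $\epsilon$, i.e. there are infinitely many pairwise disjoint open intervals of length at least $\epsilon$ in $(0,\infty)$ that do not intersect $D_K(\Lambda)$. Then $K$ is a polytope.
   Context: A $0$-symmetric convex body $K\subseteq\mathbb{R}^d$ (i.e. $K=-K$) defines the norm $\|x\|_K=\sup\{t\ge 0: x\notin tK\}$ on $\mathbb{R}^d$ (with $\sup\emptyset=0$). For $A\subseteq\mathbb{R}^d$ the $K$-distance set is $D_K(A)=\{\|x-y\|_K: x,y\in A\}$. A set $\Lambda\subseteq\mathbb{R}^d$ is called well-distributed if there is a constant $r>0$ such that every cube of side $r$ contains at least one point of $\Lambda$. *)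

(* Defs.v *)
From HB Require Import structures.
From mathcomp Require Import all_boot all_order all_algebra.
From mathcomp Require Import all_classical all_reals all_analysis.
Set Implicit Arguments.
Unset Strict Implicit.
Unset Printing Implicit Defensive.
Import Order.TTheory GRing.Theory Num.Theory.
Import numFieldNormedType.Exports.
Local Open Scope classical_set_scope.
Local Open Scope ring_scope.

Section Defs.
Variables (R : realType) (d : nat).
Implicit Types (K A L V : set 'rV[R]_d) (x c : 'rV[R]_d) (r : R).

Definition convex K : Prop := convex_set (K : set (convex_lmodType 'rV[R]_d)).

(* The topology on 'rV[R]_d is the product (Euclidean) one *)
Definition convex_body K : Prop := [/\ convex K, compact K & K° !=set0].

Definition symmetric0 K : Prop := K = [set - x | x in K].

(* [sup set0 = 0] in the library, as required here *)
Definition Knorm K x : R :=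
  sup [set t : R | 0 <= t /\ ~ [set t *: y | y in K] x].

Definition distance_set K A : set R :=
  [set s | exists x y, [/\ A x, A y & s = Knorm K (x - y)]].

(* The closed axis-parallel cube of side r with lowest corner c. Replacing these
   by open cubes, or by cubes of arbitrary orientation, only changes the constant
   r in [well_distributed] by a factor depending on d. *)
Definition cube c r : set 'rV[R]_d :=
  [set x | forall i, c 0 i <= x 0 i <= c 0 i + r].

Definition well_distributed L : Prop :=
  exists2 r : R, 0 < r & forall c, cube c r `&` L !=set0.

Definition convex_hull A : set 'rV[R]_d := smallest convex A.

Definition polytope K : Prop := exists2 V, finite_set V & K = convex_hull V.

End Defs.

(* The pair (a, b) encodes the open interval ]a, b[. As eps > 0 in use, the
   intervals are nonempty, so distinct pairs are distinct intervals. *)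
Definition infinitely_many_gaps (R : realType) (D : set R) (eps : R) : Prop :=
  exists G : set (R * R),
    [/\ infinite_set G,
        trivIset G (fun I => `]I.1, I.2[%classic) &
        forall I, G I ->
          [/\ eps <= I.2 - I.1,
              `]I.1, I.2[%classic `<=` `]0, +oo[%classic &
              `]I.1, I.2[%classic `&` D = set0]].

(* Main.v *)
Require Import Defs.
From HB Require Import structures.
From mathcomp Require Import all_boot all_order all_algebra.
From mathcomp Require Import all_classical all_reals all_analysis.
From mathcomp Require Import ring lra.
Import Order.TTheory GRing.Theory Num.Theory.
Import numFieldNormedType.Exports.
Local Open Scope classical_set_scope.
Local Open Scope ring_scope.
Set Implicit Arguments.
Unset Strict Implicit.
Unset Printing Implicit Defensive.

(* Let N be the norm of K. If w is the derivative of N at a point p of the unit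
   sphere, then N (t p + v) = t + w(v) + o(1) as t tends to infinity, so a gap of
   the distance set at a large t yields slabs {x | |w(x) - c| < eps/4} that avoid
   the set L near the origin; by well-distribution there is one such slab in
   every window of fixed length. For n pairwise nonparallel derivatives w_i the
   slab families are nearly pairwise independent, so a second moment estimate
   gives, for n large, a cube all of whose small cells are covered by slabs;
   this cube misses L. Hence the derivatives of N lie on finitely many lines.
   Every point outside K is cut off by a derivative, taken at the point of
   {N >= 1} nearest to a centre inside K, so K is a bounded intersection of
   finitely many half-spaces. *)

(** * Linear functionals on row vectors *)

Section Dot.
Variables (R : realType) (d : nat).
Implicit Types (w x y : 'rV[R]_d) (a : R).

Definition dot w x : R := \sum_i w 0 i * x 0 i.

Lemma dotC w x : dot w x = dot x w.
Proof. by apply: eq_bigr => i _; rewrite mulrC. Qed.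

Lemma dotDr w x y : dot w (x + y) = dot w x + dot w y.
Proof. by rewrite -big_split; apply: eq_bigr => i _; rewrite mxE mulrDr. Qed.

Lemma dotZr w a x : dot w (a *: x) = a * dot w x.
Proof. by rewrite mulr_sumr; apply: eq_bigr => i _; rewrite mxE mulrCA. Qed.

Lemma dot0r w : dot w 0 = 0.
Proof. by rewrite -(scale0r 0) dotZr mul0r. Qed.

Lemma dotNr w x : dot w (- x) = - dot w x.
Proof. by rewrite -scaleN1r dotZr mulN1r. Qed.

Lemma dotBr w x y : dot w (x - y) = dot w x - dot w y.
Proof. by rewrite dotDr dotNr. Qed.

Lemma dotDl w x y : dot (w + x) y = dot w y + dot x y.
Proof. by rewrite dotC dotDr !(dotC y). Qed.

Lemma dotZl w a x : dot (a *: w) x = a * dot w x.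
Proof. by rewrite dotC dotZr dotC. Qed.

Lemma dotNl w x : dot (- w) x = - dot w x.
Proof. by rewrite dotC dotNr dotC. Qed.

Lemma dot_sumr w (I : finType) (F : I -> 'rV[R]_d) :
  dot w (\sum_i F i) = \sum_i dot w (F i).
Proof. exact: (big_morph _ (dotDr w) (dot0r w)). Qed.

Definition dotE := (dotDr, dotDl, dotZr, dotZl, dotNr, dotNl).

Lemma dot_addZ x y a :
  dot (x + a *: y) (x + a *: y) = dot x x + 2 * a * dot x y + a ^+ 2 * dot y y.
Proof. by rewrite !dotE (dotC y x); ring. Qed.

Lemma dot_ge0 x : 0 <= dot x x.
Proof. by apply: sumr_ge0 => i _; rewrite -expr2 sqr_ge0. Qed.

Lemma dot_eq0 x : dot x x = 0 -> x = 0.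
Proof.
move=> /eqP; rewrite psumr_eq0 => [/allP h|i _]; last by rewrite -expr2 sqr_ge0.
apply/rowP => i; rewrite mxE.
by have /= := h i (mem_index_enum i); rewrite mulf_eq0 orbb => /eqP.
Qed.

Lemma dot_gt0 x : x != 0 -> 0 < dot x x.
Proof.
by move=> x0; rewrite lt0r dot_ge0 andbT; apply: contra_neq x0 => /dot_eq0.
Qed.

Lemma coord_le_norm x i : `|x 0 i| <= `|x|.
Proof.
rewrite [leRHS]mx_normrE.
by apply: (@le_bigmax _ R _ 0 (fun ij : 'I_1 * 'I_d => `|x ij.1 ij.2|) (0, i)).
Qed.

Lemma norm_le_coord x a : 0 <= a -> (forall i, `|x 0 i| <= a) -> `|x| <= a.
Proof.
move=> a0 h; rewrite [leLHS]mx_normrE; apply: bigmax_le => // -[i j] _ /=.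
by rewrite ord1.
Qed.

Lemma dot_norm_le w x : `|dot w x| <= (\sum_i `|w 0 i|) * `|x|.
Proof.
rewrite mulr_suml (le_trans (ler_norm_sum _ _ _))//.
by apply: ler_sum => i _; rewrite normrM ler_wpM2l// coord_le_norm.
Qed.

Lemma norm_sqr_le_dot x : `|x| ^+ 2 <= dot x x.
Proof.
rewrite -[leRHS]sqr_sqrtr ?dot_ge0// lerXn2r ?nnegrE ?sqrtr_ge0//.
apply: norm_le_coord => [|i]; first exact: sqrtr_ge0.
rewrite -sqrtr_sqr ler_sqrt ?dot_ge0// /dot (bigD1 i)//= -expr2 lerDl.
by apply: sumr_ge0 => j _; rewrite -expr2 sqr_ge0.
Qed.

Lemma dot_continuous (f g : 'rV[R]_d -> 'rV[R]_d) :
  continuous f -> continuous g -> continuous (fun x => dot (f x) (g x)).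
Proof.
move=> cf cg; apply: continuous_big => [|i _ x]; first exact: add_continuous.
have coord (h : 'rV[R]_d -> 'rV[R]_d) : continuous h ->
    {for x, continuous (fun y => h y 0 i)}.
  by move=> ch; exact: (cvg_comp _ _ (ch x) (@coord_continuous _ _ _ 0 i (h x))).
exact: (continuousM (coord f cf) (coord g cg)).
Qed.

End Dot.

(** * The norm of a convex body *)

(** The last two clauses compare [N] with the sup norm; the last one gives nonnegativity and
    definiteness. *)
Definition is_norm (R : realType) (d : nat) (N : 'rV[R]_d -> R) : Prop :=
  [/\ forall x y, N (x + y) <= N x + N y,
      forall a x, N (a *: x) = `|a| * N x,
      exists2 C, 0 < C & forall x, N x <= C * `|x| &
      exists2 D, 0 < D & forall x, `|x| <= D * N x].

Section Body.
Variables (R : realType) (d : nat).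
Implicit Types (x y : 'rV[R]_d) (t : R).

Lemma convex_comb (K : set 'rV[R]_d) x y t : convex K -> 0 <= t <= 1 ->
  K x -> K y -> K (t *: x + (1 - t) *: y).
Proof.
move=> cK /andP[t0 t1] Kx Ky.
have ti : Itv.spec (@Itv.num_sem R) (Itv.Real `[0%Z, 1%Z]) t.
  by rewrite /= /Itv.num_sem/= realE t0 /= in_itv/= t0 t1.
have := cK x y (Itv.Def ti).
by rewrite !inE => /(_ Kx Ky).
Qed.

Lemma scaled_mem (K : set 'rV[R]_d) t x : 0 < t ->
  [set t *: y | y in K] x <-> K (t^-1 *: x).
Proof.
move=> t0; split=> [[y Ky <-]|Kx].
  by rewrite scalerA mulVf ?gt_eqF// scale1r.
by exists (t^-1 *: x) => //; rewrite scalerA mulfV ?gt_eqF// scale1r.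
Qed.

Variable K : set 'rV[R]_d.
Hypotheses (hK : convex_body K) (hKs : symmetric0 K).

Local Notation Knorm_set x :=
  [set t : R | 0 <= t /\ ~ [set t *: y | y in K] x].

Lemma body_opp x : K x -> K (- x).
Proof. by move=> Kx; rewrite hKs; exists x. Qed.

(** The interior point [c] need not be 0, but symmetry puts [- c] in [K], and [x] is the midpoint of
    [c + 2 *: x] and [- c]. *)
Lemma body_ball : exists2 rho : R, 0 < rho & forall x, `|x| < rho -> K x.
Proof.
have [cK _ [c]] := hK; rewrite /interior /= => /nbhs_ballP[rho rho0 sub].
exists (rho / 2) => [|x xr]; first by rewrite divr_gt0.
have -> : x = 2^-1 *: (c + 2 *: x) + (1 - 2^-1) *: (- c).
  by apply/rowP => i; rewrite !mxE; field.
apply: convex_comb => //; first by lra.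
- apply: sub; rewrite -ball_normE /ball_ /= opprD addNKr normrN normrZ.
  by rewrite ger0_norm//; lra.
- apply: body_opp; apply: sub; exact: ballxx.
Qed.

Lemma body0 : K 0.
Proof. by have [r r0] := body_ball; apply; rewrite normr0. Qed.

Lemma body_shrink t x : 0 <= t <= 1 -> K x -> K (t *: x).
Proof.
move=> t01 Kx; have [cK _ _] := hK.
by have := convex_comb cK t01 Kx body0; rewrite scaler0 addr0.
Qed.

Lemma Knorm_set_ub t x : 0 < t -> K (t^-1 *: x) ->
  ubound (Knorm_set x) t.
Proof.
move=> t0 Kx s [s0 nsK]; rewrite leNgt; apply/negP => ts; apply: nsK.
have s1 : 0 < s by exact: lt_trans ts.
apply/scaled_mem => //.
have -> : s^-1 *: x = (t / s) *: (t^-1 *: x).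
  by rewrite scalerA mulrAC mulfV ?gt_eqF// mul1r.
apply: body_shrink => //.
by rewrite divr_ge0 ?(ltW t0) ?(ltW s1)//= ler_pdivrMr// mul1r ltW.
Qed.

Lemma Knorm_le t x : 0 < t -> K (t^-1 *: x) -> Knorm K x <= t.
Proof.
move=> t0 Kx; rewrite /Knorm.
have [->|/set0P ne] := eqVneq (Knorm_set x) set0.
  by rewrite sup0 ltW.
by apply: ge_sup => //; exact: Knorm_set_ub.
Qed.

(** Boundedness goes with the estimate because [sup] takes a default value on unbounded sets. *)
Lemma Knorm_bound : exists2 C : R, 0 < C & forall x, Knorm K x <= C * `|x| /\
   has_ubound (Knorm_set x).
Proof.
have [rho rho0 sub] := body_ball; exists (2 / rho); first by rewrite divr_gt0.
move=> x; have [->|x0] := eqVneq x 0.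
  rewrite normr0 mulr0; split.
    apply/ler_addgt0Pl => e e0; rewrite addr0; apply: Knorm_le => //.
    by rewrite scaler0; exact: body0.
  by exists 1; apply: Knorm_set_ub => //; rewrite scaler0; exact: body0.
have xp : 0 < `|x| by rewrite normr_gt0.
have t0 : 0 < 2 / rho * `|x| by rewrite mulr_gt0// divr_gt0.
suff Kx : K ((2 / rho * `|x|)^-1 *: x).
  by split; [exact: Knorm_le | eexists; exact: (Knorm_set_ub t0)].
apply: sub; rewrite normrZ ger0_norm ?invr_ge0 ?ltW//.
have -> : (2 / rho * `|x|)^-1 * `|x| = rho / 2.
  by field; rewrite !gt_eqF.
lra.
Qed.

Lemma Knorm_ge0 x : 0 <= Knorm K x.
Proof.
have [C _ /(_ x)[_ ub]] := Knorm_bound.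
rewrite /Knorm.
have [->|/set0P[t tP]] := eqVneq (Knorm_set x) set0.
  by rewrite sup0.
by apply: (@le_trans _ _ t); [case: tP | exact: ub_le_sup].
Qed.

Lemma Knorm_lt t x : Knorm K x < t -> K (t^-1 *: x).
Proof.
move=> xt; have t0 : 0 < t by exact: le_lt_trans (Knorm_ge0 x) xt.
have [C _ /(_ x)[_ ub]] := Knorm_bound.
apply: contrapT => nK; move: xt; apply/negP; rewrite -leNgt.
apply: ub_le_sup => //; split; first exact: ltW.
by move/scaled_mem => /(_ t0).
Qed.

Lemma Knorm_triangle x y : Knorm K (x + y) <= Knorm K x + Knorm K y.
Proof.
apply/ler_addgt0Pl => e e0.
set s := Knorm K x + e / 2; set t := Knorm K y + e / 2.
have e2 : 0 < e / 2 by rewrite divr_gt0.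
have s0 : 0 < s by rewrite ltr_wpDl// Knorm_ge0.
have t0 : 0 < t by rewrite ltr_wpDl// Knorm_ge0.
have st0 : 0 < s + t by rewrite addr_gt0.
have -> : e + (Knorm K x + Knorm K y) = s + t by rewrite /s /t; field.
apply: Knorm_le => //.
have -> : (s + t)^-1 *: (x + y) =
    (s / (s + t)) *: (s^-1 *: x) + (1 - s / (s + t)) *: (t^-1 *: y).
  by apply/rowP => i; rewrite !mxE; field; rewrite !gt_eqF.
have [cK _ _] := hK; apply: convex_comb => //.
- by rewrite divr_ge0 ?(ltW s0) ?(ltW st0)//= ler_pdivrMr// mul1r lerDl ltW.
- by apply: Knorm_lt; rewrite ltrDl.
- by apply: Knorm_lt; rewrite ltrDl.
Qed.

Lemma KnormZ a x : Knorm K (a *: x) = `|a| * Knorm K x.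
Proof.
have pos b y : 0 < b -> Knorm K (b *: y) <= b * Knorm K y.
  move=> b0; apply/ler_addgt0Pl => e e0.
  have -> : e + b * Knorm K y = b * (Knorm K y + e / b).
    by field; rewrite gt_eqF.
  have eb : 0 < e / b by rewrite divr_gt0.
  apply: Knorm_le; first by rewrite mulr_gt0// ltr_wpDl// Knorm_ge0.
  rewrite scalerA invfM mulrAC mulVf ?gt_eqF// mul1r.
  by apply: Knorm_lt; rewrite ltrDl.
have posE b y : 0 < b -> Knorm K (b *: y) = b * Knorm K y.
  move=> b0; apply/eqP; rewrite eq_le pos//=.
  have := @pos b^-1 (b *: y); rewrite invr_gt0 => /(_ b0).
  by rewrite scalerA mulVf ?gt_eqF// scale1r ler_pdivlMl.
have opp y : Knorm K (- y) <= Knorm K y.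
  apply/ler_addgt0Pl => e e0; apply: Knorm_le.
    by rewrite ltr_pwDl// Knorm_ge0.
  by rewrite scalerN; apply/body_opp/Knorm_lt; rewrite ltrDr.
have oppE y : Knorm K (- y) = Knorm K y.
  by apply/eqP; rewrite eq_le opp/= -{1}(opprK y) opp.
have [->|a0] := eqVneq a 0.
  have [C _ /(_ 0)[le0 _]] := Knorm_bound.
  rewrite scale0r normr0 mul0r; apply/eqP.
  by rewrite eq_le Knorm_ge0 andbT (le_trans le0)// normr0 mulr0.
have [an|ap] := ltP a 0.
  by rewrite ltr0_norm// -posE ?oppr_gt0// scaleNr oppE.
by rewrite ger0_norm// posE// lt_neqAle eq_sym a0.
Qed.

Lemma Knorm_is_norm : is_norm (Knorm K).
Proof.
split; [exact: Knorm_triangle | exact: KnormZ | |].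
  have [C C0 h] := Knorm_bound; exists C => // x; by case: (h x).
have [_ /compact_bounded[M [Mr hM]] _] := hK.
have M1 : M < `|M| + 1 by rewrite ltr_pwDr// ler_norm.
exists (`|M| + 1) => [|x]; first by rewrite ltr_pwDr.
apply/ler_addgt0Pl => e e0.
set D := `|M| + 1; have D0 : 0 < D by rewrite ltr_pwDr.
set t := Knorm K x + e / D.
have t0 : 0 < t by rewrite ltr_wpDl ?divr_gt0// Knorm_ge0.
have -> : e + D * Knorm K x = t * D by rewrite /t; field; rewrite gt_eqF.
have /(hM _ M1) /= : K (t^-1 *: x) by apply: Knorm_lt; rewrite ltrDl divr_gt0.
by rewrite normrZ gtr0_norm ?invr_gt0// ler_pdivrMl.
Qed.

Lemma Knorm_le1 x : K x <-> Knorm K x <= 1.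
Proof.
split=> [Kx|x1]; first by apply: Knorm_le => //; rewrite invr1 scale1r.
have [_ /compact_closed cK _] := hK.
have {}cK := cK (@norm_hausdorff _ _).
apply: cK => U /nbhs_ballP[r /= r0 sub].
(* Since [K] is closed, points of [K] arbitrarily near [x] suffice; this [t > 1] puts [t^-1 *: x]
   within [r] of [x]. *)
set t := 1 + r / (`|x| + 1).
have x0 : 0 < `|x| + 1 by rewrite ltr_pwDr.
have rx : 0 < r / (`|x| + 1) by rewrite divr_gt0.
have t0 : 0 < t by rewrite ltr_pwDl// ltW.
exists (t^-1 *: x); split.
  by apply: Knorm_lt; rewrite (le_lt_trans x1)// /t ltrDl.
apply: sub; rewrite -ball_normE /ball_ /=.
have -> : x - t^-1 *: x = (r / (`|x| + 1) / t) *: x.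
  rewrite -[X in X - _]scale1r -scalerBl; congr (_ *: _).
  by rewrite /t; field; rewrite ?gt_eqF// addr_gt0.
rewrite normrZ gtr0_norm ?divr_gt0// mulrAC ltr_pdivrMr//.
have qr : r / (`|x| + 1) * (`|x| + 1) = r by rewrite divfK ?gt_eqF.
have : 0 < r * (r / (`|x| + 1)) by rewrite mulr_gt0.
rewrite /t; nra.
Qed.

End Body.

(** * Points of differentiability of a norm *)

Section Smooth.
Variables (R : realType) (d : nat) (N : 'rV[R]_d -> R).
Hypothesis hN : is_norm N.
Implicit Types (w x y z p c v : 'rV[R]_d).

(* The last clause says that [dot w] is the derivative of [N] at [p]: by
   homogeneity it bounds [N (p + v / t) - N p - dot w v / t] by [eta / t], and
   the reverse inequality follows from [dot w x <= N x]. *)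
Definition smooth_at p w : Prop :=
  [/\ N p = 1, dot w p = 1, forall x, dot w x <= N x &
      forall M eta : R, 0 < eta -> exists t0, forall t v, t0 <= t -> `|v| <= M ->
        N (t *: p + v) <= t + dot w v + eta].

Definition smooth_functional w : Prop := exists p, smooth_at p w.

Lemma is_normN x : N (- x) = N x.
Proof. by have [_ nZ _ _] := hN; rewrite -scaleN1r nZ normrN1 mul1r. Qed.

Lemma is_norm_ge0 x : 0 <= N x.
Proof.
have [_ _ _ [D D0 h]] := hN.
by rewrite -(pmulr_rge0 _ D0) (le_trans _ (h x)).
Qed.

Lemma is_normB_le x y : N x - N y <= N (x - y).
Proof. by have [nD _ _ _] := hN; rewrite lerBlDr (le_trans _ (nD _ _))// subrK. Qed.

Lemma is_norm_continuous : continuous N.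
Proof.
have [_ _ [C C0 hC] _] := hN.
move=> x; apply/(@cvgrPdist_le _ _ _ (nbhs x) (nbhs_filter x)) => e e0.
apply/nbhs_ballP.
exists (e / C) => /= [|y]; first by rewrite divr_gt0.
rewrite -ball_normE /ball_ /= => xy.
have hxy : N (x - y) <= e.
  by rewrite (le_trans (hC _))// mulrC -ler_pdivlMr// ltW.
have h1 := is_normB_le x y; have := is_normB_le y x.
rewrite -(is_normN (y - x)) opprB => h2.
by rewrite ler_norml; apply/andP; split; lra.
Qed.

Lemma nearest_point c z : 1 <= N z -> exists2 p, 1 <= N p &
  forall y, 1 <= N y -> dot (p - c) (p - c) <= dot (y - c) (y - c).
Proof.
move=> z1; set D := dot (z - c) (z - c).
have cf : continuous (fun y => dot (y - c) (y - c)).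
  have cB : continuous (fun y : 'rV[R]_d => y - c).
    move=> y; apply: (@continuousB _ _ _ id (cst c) y); first exact: cvg_id.
    exact: cst_continuous.
  exact: dot_continuous.
(* Only points no farther from [c] than [z] compete, which makes the constraint set compact. *)
pose A := [set y | 1 <= N y] `&` [set y | dot (y - c) (y - c) <= D].
have cA : closed A.
  apply: closedI.
    by apply: (preimage_closed (fun y _ => is_norm_continuous (x := y)) (@closed_ge R 1)).
  by apply: (preimage_closed (fun y _ => cf y) (@closed_le R D)).
have bA : bounded_set A.
  exists (`|c| + (D + 1)); split; first exact: num_real.
  move=> M DM y [_ /= yD]; apply: le_trans (ltW DM).
  rewrite -[y](subrK c) addrC (le_trans (ler_normD _ _))// lerD2l.
  have := norm_sqr_le_dot (y - c); nra.
have [p] := EVT_min_rV (ex_intro _ z (conj z1 (lexx D)))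
   (bounded_closed_compact bA cA) (continuous_subspaceT cf).
rewrite inE => -[p1 pD] pmin; exists p => // y y1.
have [yD|/ltW yD] := leP (dot (y - c) (y - c)) D; last exact: le_trans yD.
by apply: pmin; rewrite inE.
Qed.

(* The Euclidean ball of centre [c] through [p] lies in the unit ball of [N]: it
   forces both the supporting hyperplane at [p] and, being round, the
   differentiability of [N] there. *)
Lemma nearest_point_smooth c p : N c < 1 -> 1 <= N p ->
  (forall y, 1 <= N y -> dot (p - c) (p - c) <= dot (y - c) (y - c)) ->
  smooth_at p ((dot (p - c) p)^-1 *: (p - c)).
Proof.
move=> c1 p1 pmin; have [nD nZ [C C0 hC] _] := hN.
set a := p - c; set rho := dot a a.
have inball y : dot (y - c) (y - c) < rho -> N y < 1.
  by move=> yr; rewrite ltNge; apply/negP => /pmin; rewrite leNgt yr.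
have a0 : a != 0.
  by apply/eqP => /eqP; rewrite subr_eq0 => /eqP pc; move: p1; rewrite pc leNgt c1.
have rho0 : 0 < rho by exact: dot_gt0.
have supp x : N x <= 1 -> dot a (x - c) <= rho.
  (* Otherwise [p] is a convex combination of [x] and a point of the open ball. *)
  move=> x1; rewrite leNgt; apply/negP => lt.
  set b := dot a (x - p); set e := dot (x - p) (x - p).
  have bE : b = dot a (x - c) - rho.
    by rewrite /b /rho -dotBr; congr dot; rewrite /a opprB addrA subrK.
  have b0 : 0 < b by rewrite bE subr_gt0.
  have e0 : 0 <= e by exact: dot_ge0.
  (* As [t * e < 2 * b], the step from [p] away from [x] enters the open ball. *)
  pose t := b / (e + 1).
  have e1 : 0 < e + 1 by rewrite ltr_wpDl.
  have t0 : 0 < t by rewrite divr_gt0.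
  have te : t * e < b + b.
    by rewrite /t mulrAC ltr_pdivrMr//; nra.
  have y1 : N (p - t *: (x - p)) < 1.
    apply: inball.
    have -> : p - t *: (x - p) - c = a - t *: (x - p) by rewrite addrAC.
    rewrite -scaleNr dot_addZ -/rho -/b -/e; nra.
  have : N ((1 + t) *: p) <= N (p - t *: (x - p)) + N (t *: x).
    rewrite (_ : (1 + t) *: p = p - t *: (x - p) + t *: x) ?nD//.
    by apply/rowP => i; rewrite !mxE; ring.
  rewrite !nZ !ger0_norm; [nra | lra..].
set be := dot a p.
have suppN x : dot a x <= be * N x.
  have le1 y : N y <= 1 -> dot a y <= be.
    move=> /supp; rewrite dotBr lerBlDr => /le_trans; apply.
    by rewrite /rho {2}/a dotBr subrK.
  have [->|x0] := eqVneq x 0.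
    by rewrite dot0r -[X in N X](scale0r 0) nZ normr0 mul0r mulr0.
  have Nx : 0 < N x.
    have [_ _ _ [D D0 hD]] := hN.
    by rewrite -(pmulr_rgt0 _ D0) (lt_le_trans _ (hD x))// normr_gt0.
  have := le1 ((N x)^-1 *: x); rewrite nZ gtr0_norm ?invr_gt0//.
  by rewrite mulVf ?gt_eqF// => /(_ (lexx 1)); rewrite dotZr mulrC ler_pdivrMr.
have Na0 := is_norm_ge0 a.
have Np1 : N p = 1.
  apply/eqP; rewrite eq_le p1 andbT leNgt; apply/negP => gt1.
  (* Moving [p] towards [c] by [e *: a] comes closer to [c], while [N] stays at least
     [N p - e * N a = 1 + e * N p]. *)
  set e := (N p - 1) / (N a + N p).
  have s0 : 0 < N a + N p by lra.
  have e0 : 0 < e by rewrite divr_gt0// subr_gt0.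
  have e1 : e < 1 by rewrite ltr_pdivrMr//; lra.
  have eE : e * (N a + N p) = N p - 1 by rewrite divfK ?gt_eqF.
  have y1 : N (p - e *: a) < 1.
    apply: inball.
    have -> : p - e *: a - c = (1 - e) *: a by rewrite scalerBl scale1r addrAC.
    have h1 : 0 < e * rho by rewrite mulr_gt0.
    have h2 : 0 < (1 - e) * (e * rho) by rewrite mulr_gt0// subr_gt0.
    by rewrite dotZl dotZr -/rho; nra.
  have := nD (p - e *: a) (e *: a); rewrite subrK nZ gtr0_norm//; nra.
have be0 : 0 < be.
  by have := suppN a; rewrite -/rho => h; rewrite ltNge; apply/negP => be0; nra.
set w := be^-1 *: a.
have aE v : dot a v = be * dot w v by rewrite dotZl mulrA mulfV ?gt_eqF// mul1r.
have wp : dot w p = 1 by rewrite dotZl mulVf ?gt_eqF.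
split=> //.
- by move=> x; rewrite dotZl ler_pdivrMl.
move=> M eta eta0.
set S := \sum_i `|w 0 i|; have S0 : 0 <= S by apply: sumr_ge0.
set U := M + (S * M + eta) * `|p|.
(* The threshold absorbs [dot w v >= - (S * M)] and makes [be * eta * tau] exceed [d%:R * U ^+ 2], a
   bound for [dot u u] with [u] as below. *)
exists (S * M + 1 + d%:R * U ^+ 2 / (be * eta)) => t v tt0 vM.
have M0 : 0 <= M by exact: le_trans vM.
have SM0 : 0 <= S * M by rewrite mulr_ge0.
have wv : `|dot w v| <= S * M by rewrite (le_trans (dot_norm_le _ _))// ler_wpM2l.
(* [(t *: p + v) / tau - c = a + u / tau] where [dot a u < 0]. *)
set u := v - (dot w v + eta) *: p.
have uU : `|u| <= U.
  rewrite (le_trans (ler_normB _ _))// lerD// normrZ ler_wpM2r//.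
  by rewrite (le_trans (ler_normD _ _))// lerD// gtr0_norm.
have uu : dot u u <= d%:R * U ^+ 2.
  rewrite (le_trans (ler_norm _))// (le_trans (dot_norm_le _ _))//.
  rewrite expr2 mulrA ler_pM ?sumr_ge0//.
  have -> : d%:R * U = \sum_(i < d) U by rewrite sumr_const card_ord mulr_natl.
  by apply: ler_sum => i _; exact: le_trans (coord_le_norm _ _) uU.
set tau := t + dot w v + eta.
have bee : 0 < be * eta by rewrite mulr_gt0.
have tauU : dot u u < be * eta * tau.
  apply: (le_lt_trans uu); rewrite -ltr_pdivrMl// mulrC.
  by move: wv; rewrite ler_norml => /andP[wv _]; rewrite /tau; lra.
have tau0 : 0 < tau.
  by rewrite -(pmulr_rgt0 _ bee) (le_lt_trans _ tauU)// dot_ge0.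
have y1 : N (tau^-1 *: (t *: p + v)) < 1.
  apply: inball.
  have -> : tau^-1 *: (t *: p + v) - c = a + tau^-1 *: u.
    by apply/rowP => i; rewrite !mxE /tau; field; rewrite gt_eqF.
  rewrite dot_addZ -/rho.
  have -> : dot a u = - (be * eta).
    by rewrite aE dotBr dotZr wp; ring.
  have h : tau^-1 ^+ 2 * dot u u < tau^-1 * (be * eta).
    by rewrite expr2 -mulrA ltr_pM2l ?invr_gt0// ltr_pdivrMl// mulrC.
  have : 0 < tau^-1 * (be * eta) by rewrite mulr_gt0 ?invr_gt0.
  by lra.
by move: y1; rewrite nZ gtr0_norm ?invr_gt0// ltr_pdivrMl// mulr1 => /ltW.
Qed.

(** Scale [z] to [z0] on the unit sphere and put the centre [c] just inside. The point [p] nearest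
    to [c] is within [s * E] of [z0] in the norm [N], so the derivative at [p] is at least
    [1 - s * E] at [z0], which exceeds [(N z)^-1] for small [s]. *)
Lemma smooth_functional_separates z : 1 < N z ->
  exists2 w, smooth_functional w & 1 < dot w z.
Proof.
move=> z1; have [nD nZ [C C0 hC] _] := hN.
have Nz0 : 0 < N z by lra.
set z0 := (N z)^-1 *: z.
have Nz01 : N z0 = 1 by rewrite nZ gtr0_norm ?invr_gt0// mulVf ?gt_eqF.
set E := C * (`|z0| + Num.sqrt (dot z0 z0)).
have E0 : 0 <= E by rewrite mulr_ge0 ?(ltW C0)// addr_ge0// sqrtr_ge0.
set k := 1 - (N z)^-1.
have Nzi : (N z)^-1 < 1 by rewrite invf_lt1.
have Nzi0 : 0 < (N z)^-1 by rewrite invr_gt0.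
pose s := k / (E + 1).
have E1 : 0 < E + 1 by rewrite ltr_wpDl.
have s0 : 0 < s by rewrite divr_gt0// subr_gt0.
have sE : s * (E + 1) = k by rewrite divfK ?gt_eqF.
have sE0 : 0 <= s * E by rewrite mulr_ge0// ltW.
have sk : s <= k by move: sE; lra.
set c := (1 - s) *: z0.
have c1 : N c < 1 by rewrite nZ Nz01 mulr1 ger0_norm; rewrite /k in sk; lra.
have z01 : 1 <= N z0 by rewrite Nz01.
have [p p1 pmin] := nearest_point c z01.
have smp := nearest_point_smooth c1 p1 pmin; move: smp.
set w := _ *: (p - c) => smp; exists w; first by exists p.
have [_ wp wN _] := smp.
set q := Num.sqrt (dot z0 z0); have q0 : 0 <= q by exact: sqrtr_ge0.
have z0c : z0 - c = s *: z0 by rewrite /c scalerBl scale1r opprB addrC subrK.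
have pc : `|p - c| <= s * q.
  have sq0 : 0 <= s * q by rewrite mulr_ge0// ltW.
  rewrite -(@ler_pXn2r _ 2)// ?nnegrE//.
  rewrite (le_trans (norm_sqr_le_dot _))// (le_trans (pmin _ z01))//.
  by rewrite z0c dotZl dotZr exprMn sqr_sqrtr ?dot_ge0// mulrA.
have pz : N (p - z0) <= s * E.
  rewrite (le_trans (hC _))// /E mulrCA ler_wpM2l ?(ltW C0)//.
  have -> : p - z0 = (p - c) - (z0 - c) by rewrite opprB addrA subrK.
  rewrite (le_trans (ler_normB _ _))// z0c normrZ gtr0_norm// mulrDr addrC.
  by rewrite lerD2l.
have wz0 : 1 - s * E <= dot w z0.
  by have := wN (p - z0); rewrite dotBr wp; lra.
have -> : z = N z *: z0 by rewrite scalerA mulfV ?gt_eqF// scale1r.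
rewrite dotZr -ltr_pdivrMl// mulr1 (lt_le_trans _ wz0)//.
by rewrite /k in sE; lra.
Qed.

End Smooth.

(** * Polytopes as intersections of half-spaces *)

Section Polytope.
Variables (R : realType) (d : nat).
Implicit Types (x v : 'rV[R]_d) (K : set 'rV[R]_d).

Lemma convex_halfspaces (I : Type) (w : I -> 'rV[R]_d) K :
  (forall x, K x <-> forall i, dot (w i) x <= 1) -> convex K.
Proof.
move=> KE x y k; rewrite !inE !KE => hx hy i; rewrite dotDr !dotZr.
have k0 : 0 <= k%:num by [].
have k1 : k%:num <= 1 by [].
have := hx i; have := hy i; rewrite /unstable.onem; nra.
Qed.

(** From a point that is no vertex, go both ways along a line on which the active constraints are
    constant, until a new one becomes active. The point lies between the two exits; induct on the
    number of inactive constraints. *)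
Lemma halfspaces_polytope (I : finType) (w : I -> 'rV[R]_d) K :
  (forall x, K x <-> forall i, dot (w i) x <= 1) ->
  (forall v, v != 0 -> exists i, 0 < dot (w i) v) -> polytope K.
Proof.
move=> KE bnd.
pose act x : {set I} := [set i | dot (w i) x == 1]%SET.
(* The vertices: each is determined by its set of active constraints, so there are finitely many. *)
pose V := [set x | K x /\ forall v, (forall i, i \in act x -> dot (w i) v = 0) -> v = 0].
have Vinj x y : V x -> V y -> act x = act y -> x = y.
  move=> [_ Vx] _ xy; apply/eqP; rewrite -subr_eq0; apply/eqP/Vx => i ix.
  have : i \in act y by rewrite -xy.
  by move: ix; rewrite !inE dotBr => /eqP-> /eqP->; rewrite subrr.
exists V.
  pose g A := xget 0 [set x | V x /\ act x = A].
  apply: (@sub_finite_set _ _ (g @` setT)); last exact: finite_image.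
  move=> x Vx; exists (act x) => //.
  by rewrite /g; case: xgetP => [y _ [Vy yx]|/(_ x)]; [exact: Vinj | case].
have exit x v : K x -> v != 0 -> (forall i, i \in act x -> dot (w i) v = 0) ->
    exists s : R, [/\ 0 < s, K (x + s *: v) & act x \proper act (x + s *: v)].
  move=> Kx /bnd[i0 i0v] av.
  have [i iv imin] := @Order.TotalTheory.arg_minP _ _ _ i0
    (fun i => 0 < dot (w i) v) (fun i => (1 - dot (w i) x) / dot (w i) v) i0v.
  set s := (1 - dot (w i) x) / dot (w i) v in imin.
  have xi : dot (w i) x != 1.
    by apply/eqP => xi; move: iv; rewrite av ?inE ?xi ?eqxx// ltxx.
  have s0 : 0 < s.
    by rewrite divr_gt0// subr_gt0 lt_neqAle xi/=; move/KE: Kx; apply.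
  exists s; split=> //.
    apply/KE => j; rewrite dotDr dotZr.
    have xj : dot (w j) x <= 1 by move/KE: Kx; apply.
    have [vj|vj] := leP (dot (w j) v) 0; first by nra.
    by have := imin j vj; rewrite ler_pdivlMr//; lra.
  apply/properP; split.
    apply/fintype.subsetP => j jx; move: (jx).
    by rewrite !inE dotDr dotZr av// mulr0 addr0.
  exists i; last by rewrite inE.
  by rewrite inE dotDr dotZr /s divfK ?(gt_eqF iv)// addrC subrK.
apply/seteqP; split; last first.
  by apply: smallest_sub => [|x []//]; exact: convex_halfspaces KE.
move=> x Kx C [cC VC].
have [n] := ubnP #|~: act x|; elim: n x Kx => // n IH x Kx; rewrite ltnS => xn.
have [Vx|nVx] := pselect (V x); first exact: VC.
have [v v0 av] : exists2 v, v != 0 & forall i, i \in act x -> dot (w i) v = 0.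
  apply: contrapT => nv; apply: nVx; split=> // v av.
  by apply/eqP; apply: contrapT => /negP v0; apply: nv; exists v.
have step y : K y -> act x \proper act y -> C y.
  move=> Ky xy; apply: IH => //; apply: leq_trans xn.
  by apply: proper_card; rewrite properC.
have [s [s0 Ks xs]] := exit x v Kx v0 av.
have [|i ix|t [t0 Kt xt]] := exit x (- v) Kx; first by rewrite oppr_eq0.
  by rewrite dotNr av// oppr0.
have st0 : 0 < s + t by rewrite addr_gt0.
have -> : x = (t / (s + t)) *: (x + s *: v) + (1 - t / (s + t)) *: (x + t *: - v).
  by apply/rowP => i; rewrite !mxE; field; rewrite gt_eqF.
apply: convex_comb => //; [|exact: step|exact: step].
by rewrite divr_ge0 ?(ltW t0) ?(ltW st0)//= ler_pdivrMr// mul1r lerDr ltW.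
Qed.

Lemma dominated_polytope (N : 'rV[R]_d -> R) K (s : seq 'rV[R]_d) :
  is_norm N -> (forall x, K x <-> N x <= 1) ->
  (forall w, w \in s -> smooth_functional N w) ->
  (forall w, smooth_functional N w ->
    exists2 u, u \in s & forall x, `|dot w x| <= `|dot u x|) ->
  polytope K.
Proof.
move=> hN KE sN sdom; have [_ nZ _ [D D0 hD]] := hN.
pose w (ib : 'I_(size s) * bool) := (-1) ^+ ib.2 *: nth 0 s ib.1.
have sep x : 1 < N x -> exists i, 1 < dot (w i) x.
  move=> /(smooth_functional_separates hN)[u /sdom[u' u's uu'] ux].
  have := lt_le_trans (lt_le_trans ux (ler_norm _)) (uu' x).
  have us : (index u' s < size s)%N by rewrite index_mem.
  rewrite /w lter_normr => /orP[gt1|gt1].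
    by exists (Ordinal us, false); rewrite /= nth_index// expr0 scale1r.
  by exists (Ordinal us, true); rewrite /= nth_index// expr1 scaleN1r dotNl.
apply: (@halfspaces_polytope _ w).
  move=> x; rewrite KE; split=> [x1 [i b]|wx].
    have [p [_ _ le _]] := sN _ (mem_nth 0 (ltn_ord i)).
    rewrite /w /= dotZl; case: b; rewrite ?expr0 ?expr1 ?mul1r ?mulN1r.
      by rewrite -dotNr (le_trans (le _))// is_normN.
    by rewrite (le_trans (le _)).
  by rewrite leNgt; apply/negP => /sep[i]; rewrite ltNge wx.
move=> v v0.
have Nv : 0 < N v.
  by rewrite -(pmulr_rgt0 _ D0) (lt_le_trans _ (hD v))// normr_gt0.
(* The multiple of [v] of norm 2 violates a constraint, which is therefore positive on [v]. *)
have [|i] := sep ((2 / N v) *: v).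
  by rewrite nZ gtr0_norm ?divr_gt0// divfK ?gt_eqF//; lra.
rewrite dotZr => gt1; exists i.
rewrite -(@pmulr_rgt0 _ (2 / N v)) ?divr_gt0//; lra.
Qed.

(** The Gram determinant, zero exactly when [u] and [v] are linearly dependent. *)
Definition gram (u v : 'rV[R]_d) : R := dot u u * dot v v - dot u v ^+ 2.

Lemma gramC u v : gram u v = gram v u.
Proof. by rewrite /gram mulrC dotC. Qed.

(** Dependence gives [w = l *: u]. At the point [q] where [u] is the derivative, [dot u q = 1], so
    the absolute value of [l] is that of [dot w q], at most [N q = 1]. *)
Lemma gram0_dominated N w u : is_norm N ->
  smooth_functional N w -> smooth_functional N u -> gram u w = 0 ->
  forall x, `|dot w x| <= `|dot u x|.
Proof.
move=> hN [p [Np wp wN _]] [q [Nq uq uN _]] g0 x.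
have u0 : u != 0.
  by apply: contra_eq_neq uq => ->; rewrite dotC dot0r eq_sym oner_eq0.
have uu := dot_gt0 u0.
have wE : w = (dot u w / dot u u) *: u.
  apply/eqP; rewrite -subr_eq0; apply/eqP/dot_eq0.
  rewrite -scaleNr dot_addZ (dotC w u).
  have -> : dot w w = dot u w ^+ 2 / dot u u.
    apply: (mulfI (lt0r_neq0 uu)).
    rewrite mulrCA mulfV ?gt_eqF// mulr1.
    by apply/eqP; rewrite -subr_eq0 -/(gram u w) g0.
  by field; rewrite gt_eqF.
set l := _ / _ in wE.
have wx y : dot w y = l * dot u y by rewrite wE dotZl.
have wq : dot w q = l by rewrite wx uq mulr1.
have l1 : `|l| <= 1.
  rewrite ler_norml -wq; have := wN q; have := wN (- q).
  by rewrite (is_normN hN) dotNr Nq => h1 h2; apply/andP; split; lra.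
by rewrite wx normrM ler_piMl.
Qed.

(** Greedy choice: extend the list by a member of [P] parallel to none of its entries, for as long
    as there is one. *)
Lemma many_nonparallel_or_dominated (P : set 'rV[R]_d) (n : nat) :
  (exists w : 'I_n -> 'rV[R]_d, (forall i, P (w i)) /\
     forall i j, i != j -> gram (w i) (w j) != 0) \/
  (exists2 s : seq 'rV[R]_d, (forall w, w \in s -> P w) &
     forall w, P w -> exists2 u, u \in s & gram u w = 0).
Proof.
suff [[s [sn sP sg]]|?] :
    (exists s : seq 'rV[R]_d, [/\ size s = n, forall w, w \in s -> P w &
      forall i j, (i < j < n)%N -> gram (nth 0 s i) (nth 0 s j) != 0]) \/
    (exists2 s : seq 'rV[R]_d, (forall w, w \in s -> P w) &
     forall w, P w -> exists2 u, u \in s & gram u w = 0);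
    [|by right|].
  left; exists (fun i => nth 0 s i); split=> [i|i j ij].
    by apply/sP/mem_nth; rewrite sn.
  have [lt|lt|/val_inj eq] := ltngtP i j; last by move: ij; rewrite eq eqxx.
    by apply: sg; rewrite lt/=.
  by rewrite gramC sg// lt/=.
elim: n => [|n [[s [sn sP sg]]|]]; [| |by right].
  by left; exists [::]; split=> // i j; rewrite andbF.
have [h|/existsNP[w /not_implyP[Pw nw]]] :=
  pselect (forall w, P w -> exists2 u, u \in s & gram u w = 0).
  by right; exists s.
left; exists (w :: s); split=> /=.
- by rewrite sn.
- by move=> u; rewrite inE => /predU1P[->//|/sP].
move=> [|i] [|j]//=; rewrite ?ltnS => ij; last exact: sg.
rewrite gramC; apply/eqP => g0; apply: nw; exists (nth 0 s j) => //.
by rewrite mem_nth// sn.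
Qed.

End Polytope.

(** * The second moment estimate *)

Section Staircase.
Variables (R : realType) (h L : R).
Hypotheses (h0 : 0 < h) (hL : h <= L).
Implicit Types (c : int -> R) (s a : R).

(* If [c k] lies in the [k]-th cell [k L, (k + 1) L[ for every [k], then
   [stair c s] is, up to normalization, the number of points [c k] below [s]. *)
Definition stair c s : R :=
  (Num.floor (s / L))%:~R + (c (Num.floor (s / L)) < s)%R%:R.

Definition one_per_cell c : Prop :=
  forall k, k%:~R * L <= c k < (k + 1)%:~R * L.

(* The number of points [c k] in [s, s + h[, minus its expected value. *)
Definition excess c s : R := stair c (s + h) - stair c s - h / L.

Let L0 : 0 < L. Proof. exact: lt_le_trans hL. Qed.

Lemma stair_approx c s : `|stair c s - s / L| <= 1.
Proof.
have := floor_le (s / L); have := floorD1_gt (s / L).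
rewrite /stair intrD.
by case: (_ < s) => /= h1 h2; rewrite ler_norml; apply/andP; split; lra.
Qed.

Lemma excess_bound c s : `|excess c s| <= 2.
Proof.
have -> : excess c s =
    (stair c (s + h) - (s + h) / L) - (stair c s - s / L).
  by rewrite /excess; field; rewrite gt_eqF.
rewrite (le_trans (ler_normB _ _))//.
by have := stair_approx c (s + h); have := stair_approx c s; lra.
Qed.

(** The intervals abut, so the sum telescopes to a difference of two discrepancies and does not grow
    with [m]. *)
Lemma excess_sum_bound c a m : `|\sum_(k < m) excess c (a + k%:R * h)| <= 2.
Proof.
have -> : \sum_(k < m) excess c (a + k%:R * h) =
    (stair c (a + m%:R * h) - (a + m%:R * h) / L) - (stair c a - a / L).
  pose f k := stair c (a + k%:R * h) - (a + k%:R * h) / L.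
  rewrite (eq_bigr (fun k : 'I_m => f k.+1 - f k)) => [|k _].
    rewrite -(big_mkord xpredT (fun k => f k.+1 - f k)) telescope_sumr//.
    by rewrite /f mul0r addr0.
  rewrite /f /excess -natr1 mulrDl mul1r addrA.
  by field; rewrite gt_eqF.
rewrite (le_trans (ler_normB _ _))//.
by have := stair_approx c (a + m%:R * h); have := stair_approx c a; lra.
Qed.

(** As [h <= L], the floors at [s] and [s + h] differ by at most one. If they differ and no point
    lies in between, the point of the first cell is below [s] and that of the next is not below
    [s + h], so the counts agree. *)
Lemma stair_jump c s : one_per_cell c -> stair c (s + h) != stair c s ->
  exists k, s <= c k < s + h.
Proof.
move=> hc; apply: contra_neqP => nk.
have out k : (c k < s + h) = (c k < s).
  apply/idP/idP => [lt|lt]; last by rewrite (lt_le_trans lt)// lerDl ltW.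
  by rewrite ltNge; apply/negP => le; apply: nk; exists k; rewrite le lt.
rewrite /stair out.
set k := Num.floor (s / L); set l := Num.floor ((s + h) / L).
have k1 : k%:~R * L <= s by rewrite -ler_pdivlMr// floor_le.
have k2 : s < (k + 1)%:~R * L by rewrite -ltr_pdivrMr// floorD1_gt.
have l1 : l%:~R * L <= s + h by rewrite -ler_pdivlMr// floor_le.
have l2 : s + h < (l + 1)%:~R * L by rewrite -ltr_pdivrMr// floorD1_gt.
have kl : k <= l.
  rewrite -ltzD1 -(ltr_int R) -(ltr_pM2r L0) (le_lt_trans k1)//.
  by rewrite (lt_trans _ l2)// ltrDl.
have lk : l <= k + 1.
  rewrite -ltzD1 -(ltr_int R) -(ltr_pM2r L0) (le_lt_trans l1)//.
  by rewrite intrD mulrDl mul1r ltr_leD.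
have [->//|lnk] := eqVneq l k.
have lE : l = k + 1.
  by apply/eqP; rewrite eq_le lk lezD1 lt_neqAle eq_sym lnk.
have /andP[_ ck] := hc k; have /andP[cl _] := hc l.
have -> : (c k < s) = true.
  by rewrite -out (lt_le_trans ck)// -lE.
have -> : (c l < s) = false.
  by apply/negP => /(le_lt_trans cl); rewrite lE ltNge (ltW k2).
by rewrite lE intrD addr0.
Qed.

End Staircase.

Section Resample.
Variables (R : realType) (E T : finType).

Definition upd (om : {ffun E -> T}) e k : {ffun E -> T} :=
  [ffun x => if x == e then k else om x].

(** Resampling preserves the uniform measure: exchanging the value at [e] with the fresh value is an
    involution on pairs. *)
Lemma sum_resample (F : {ffun E -> T} -> R) e :
  \sum_om \sum_k F (upd om e k) = #|T|%:R * \sum_om F om.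
Proof.
transitivity (\sum_(p : {ffun E -> T} * T) F p.1); last first.
  rewrite -(pair_bigA _ (fun om _ => F om))/= mulr_sumr.
  by apply: eq_bigr => om _; rewrite sumr_const mulr_natl.
rewrite pair_bigA/=.
pose swap (p : {ffun E -> T} * T) := (upd p.1 e p.2, p.1 e).
rewrite [RHS](reindex_inj (inv_inj (_ : involutive swap)))//.
move=> [om k]; rewrite /swap/=; congr pair; last by rewrite ffunE eqxx.
by apply/ffunP => x; rewrite !ffunE; case: eqP => // ->.
Qed.

End Resample.

Section SecondMoment.
Variables (R : realType) (h L : R) (n : nat) (c : 'I_n -> int -> R).
Hypotheses (h0 : 0 < h) (hL : h <= L).

Let Om := {ffun 'I_n * 'I_n -> 'I_n}.

(* Resampling the coordinate [(i, j)] fixes [x i] and moves [x j] along an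
   arithmetic progression of step [h], over which the excess nearly cancels. *)
Definition decoupled (x : 'I_n -> Om -> R) : Prop :=
  forall i j om, i != j -> (forall k, x i (upd om (i, j) k) = x i om) /\
    exists a, forall k, x j (upd om (i, j) k) = a + k%:R * h.

(** Average over the coordinate [(i, j)] first: the factor of [i] is constant and bounded by 2, and
    the [n] factors of [j] sum to at most 2. The mean product is thus at most [4 / n]. *)
Lemma excess_correlation x i j : decoupled x -> i != j ->
  n%:R * \sum_om excess h L (c i) (x i om) * excess h L (c j) (x j om)
    <= 4 * #|{: Om}|%:R.
Proof.
move=> hx ij; have := sum_resample
  (fun om => excess h L (c i) (x i om) * excess h L (c j) (x j om)) (i, j).
rewrite card_ord => <-.
have -> : 4 * #|{: Om}|%:R = \sum_(om : Om) 4 :> R.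
  by rewrite sumr_const mulr_natr.
apply: ler_sum => om _; have [xi [a xj]] := hx i j om ij.
under eq_bigr do rewrite xi xj.
rewrite -mulr_sumr (le_trans (ler_norm _))// normrM.
have -> : 4 = 2 * 2 :> R by ring.
by apply: ler_pM => //; [exact: excess_bound | exact: excess_sum_bound].
Qed.

(** The [n] diagonal terms have mean at most 4 and the off-diagonal ones, at most [n ^ 2] in number,
    mean at most [4 / n]. *)
Lemma excess_second_moment x : decoupled x ->
  \sum_om (\sum_i excess h L (c i) (x i om)) ^+ 2 <= 8 * n%:R * #|{: Om}|%:R.
Proof.
move=> hx; have [n0|n0] := posnP n.
  rewrite big1 ?mulr_ge0// => om _; rewrite big1 ?expr0n// => i _.
  by have := ltn_ord i; rewrite {2}n0.
have nR : 0 < n%:R :> R by rewrite ltr0n.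
rewrite -(ler_pM2l nR).
under eq_bigr do rewrite expr2 big_distrlr /=.
rewrite exchange_big mulr_sumr /=.
have -> : n%:R * (8 * n%:R * #|{: Om}|%:R) =
    \sum_(i < n) (8 * n%:R * #|{: Om}|%:R) :> R.
  by rewrite sumr_const card_ord mulr_natl.
apply: ler_sum => i _; rewrite exchange_big mulr_sumr /=.
apply: (@le_trans _ _ (\sum_(j < n) ((i == j)%:R * (4 * n%:R) + 4) * #|{: Om}|%:R)).
  apply: ler_sum => j _; have [<-|ij] := eqVneq i j; last first.
    by rewrite mul0r add0r excess_correlation.
  apply: (@le_trans _ _ (n%:R * (4 * #|{: Om}|%:R))); last first.
    by rewrite mul1r; have : 0 <= #|{: Om}|%:R :> R by []; lra.
  rewrite ler_pM2l//.
  have -> : 4 * #|{: Om}|%:R = \sum_(om : Om) 4 :> R.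
    by rewrite sumr_const mulr_natr.
  apply: ler_sum => om _; rewrite -expr2 -real_normK ?num_real//.
  have -> : 4 = 2 ^+ 2 :> R by ring.
  by rewrite lerXn2r ?nnegrE// excess_bound.
rewrite -mulr_suml big_split/= -mulr_suml sumr_const card_ord.
rewrite (bigD1 i)//= eqxx big1 ?addr0 => [|j]; last by rewrite eq_sym => /negbTE->.
by rewrite -[4 *+ n]mulr_natr mul1r; lra.
Qed.

(** Chebyshev with a union bound over [A]: where no [stair] jumps, every excess is [- (h / L)], and
    the square of their sum is too large for this to happen at every [om]. *)
Lemma stair_jumps_everywhere (A : finType) (x : A -> 'I_n -> Om -> R) :
  (forall a, decoupled (x a)) -> 8 * #|A|%:R < n%:R * (h / L) ^+ 2 ->
  exists om, forall a, exists i,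
    stair L (c i) (x a i om + h) != stair L (c i) (x a i om).
Proof.
move=> hx hn; apply: contrapT => no.
have n0 : (0 < n)%N.
  by rewrite lt0n; apply: contraTneq hn => ->; rewrite mul0r -leNgt mulr_ge0.
have nR : 0 < n%:R :> R by rewrite ltr0n.
have Om0 : 0 < #|{: Om}|%:R :> R.
  by rewrite ltr0n; apply/card_gt0P; exists [ffun=> Ordinal n0].
have bad om : (n%:R * (h / L)) ^+ 2 <=
    \sum_a (\sum_i excess h L (c i) (x a i om)) ^+ 2.
  have [a ha] : exists a, forall i,
      stair L (c i) (x a i om + h) = stair L (c i) (x a i om).
    apply: contrapT => na; apply: no; exists om => a.
    apply: contrapT => ni; apply: na; exists a => i.
    by apply/eqP; apply: contrapT => /negP e; apply: ni; exists i.
  rewrite (bigD1 a)//= (eq_bigr (fun=> - (h / L))) => [|i _]; last first.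
    by rewrite /excess ha subrr sub0r.
  rewrite sumr_const card_ord mulNrn -[(h / L) *+ n]mulr_natl sqrrN lerDl.
  by apply: sumr_ge0 => b _; exact: sqr_ge0.
have : #|{: Om}|%:R * (n%:R * (h / L)) ^+ 2 <= #|A|%:R * (8 * n%:R * #|{: Om}|%:R).
  apply: (@le_trans _ _
    (\sum_(om : Om) \sum_a (\sum_i excess h L (c i) (x a i om)) ^+ 2)).
    rewrite mulr_natl -sumr_const; apply: ler_sum => om _; exact: bad.
  rewrite exchange_big/= mulr_natl -sumr_const.
  by apply: ler_sum => a _; exact: excess_second_moment.
have -> : #|A|%:R * (8 * n%:R * #|{: Om}|%:R) =
    #|{: Om}|%:R * (n%:R * (8 * #|A|%:R)) :> R by ring.
rewrite ler_pM2l// exprMn expr2 -mulrA ler_pM2l//.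
by rewrite leNgt hn.
Qed.

End SecondMoment.

(** * Gaps in the distance set *)

(** Only finitely many gaps have midpoint below [T]: midpoints in the same cell of length [eps / 2]
    would make their gaps overlap. Any other midpoint serves as [t]. *)
Lemma gaps_unbounded (R : realType) (D : set R) (eps T : R) : 0 < eps ->
  infinitely_many_gaps D eps ->
  exists2 t, T <= t & forall s, `|s - t| < eps / 2 -> ~ D s.
Proof.
move=> eps0 [G [Ginf Gtriv Ggap]]; apply: contrapT => noT; apply: Ginf.
pose mid (I : R * R) := (I.1 + I.2) / 2.
have midI I s : G I -> `|s - mid I| < eps / 2 -> `]I.1, I.2[%classic s.
  move=> /Ggap[le _ _]; rewrite /mid ltr_norml /= in_itv/= => /andP[h1 h2].
  by apply/andP; split; lra.
have mid_self I : G I -> `]I.1, I.2[%classic (mid I).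
  by move=> GI; apply: midI => //; rewrite subrr normr0 divr_gt0.
have mid0 I : G I -> 0 < mid I.
  move=> GI; have [_ pos _] := Ggap I GI.
  by have := pos _ (mid_self I GI); rewrite /= in_itv/= andbT.
have midT I : G I -> mid I < T.
  move=> GI; rewrite ltNge; apply/negP => Tm; apply: noT; exists (mid I) => // s sI Ds.
  have [_ _ /seteqP[dis _]] := Ggap I GI.
  by apply: (dis s); split; [exact: midI | exact: Ds].
pose f (I : R * R) := Num.truncn (mid I / (eps / 2)).
have e2 : 0 < eps / 2 by rewrite divr_gt0.
have finj I J : G I -> G J -> f I = f J -> I = J.
  move=> GI GJ fIJ; apply: Gtriv => //; exists (mid I).
  split; first exact: mid_self.
  apply: midI => //.
  have bnd H : G H -> (f H)%:R * (eps / 2) <= mid H < (f H).+1%:R * (eps / 2).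
    move=> GH; have /andP[t1 t2] : (f H)%:R <= mid H / (eps / 2) < (f H).+1%:R.
      by rewrite /f truncn_itv// divr_ge0// ltW// mid0.
    by rewrite -ler_pdivlMr// t1 -ltr_pdivrMr.
  have := bnd I GI; have := bnd J GJ; rewrite fIJ -natr1 => /andP[j1 j2] /andP[i1 i2].
  by rewrite ltr_norml; apply/andP; split; lra.
pose g n := xget (0, 0) [set I | G I /\ f I = n].
apply: (@sub_finite_set _ _ (g @` `I_(Num.truncn (T / (eps / 2))).+1)); last first.
  exact/finite_image/finite_II.
move=> I GI; exists (f I).
  rewrite /= ltnS /f; apply: le_truncn.
  by rewrite ler_pM2r ?invr_gt0// ltW// midT.
by rewrite /g; case: xgetP => [J _ [GJ JI]|/(_ I)]; [exact: finj | case].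
Qed.

(** * Avoided slabs and a cube covered by them *)

Section Separation.
Variables (R : realType) (d : nat) (N : 'rV[R]_d -> R) (A : set 'rV[R]_d).
Variables (r C eps L : R).
Implicit Types (c x w : 'rV[R]_d).
Hypotheses (hN : is_norm N) (C0 : 0 < C) (hC : forall x, N x <= C * `|x|).
Hypotheses (r0 : 0 < r) (hA : forall c, cube c r `&` A !=set0).
Hypotheses (eps0 : 0 < eps) (hL : 2 * (C * r) < L) (heL : eps / 8 <= L).
Hypothesis hgap : forall T : R, exists2 t : R, T <= t &
  forall x y, A x -> A y -> ~ `|N (x - y) - t| < eps / 2.

Lemma cube_norm_le c x : cube c r x -> `|x - c| <= r.
Proof.
move=> cx; apply: norm_le_coord => [|i]; first exact: ltW.
have /andP[h1 h2] := cx i.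
by rewrite !mxE ger0_norm; lra.
Qed.

Lemma functional_norm_le w x : (forall x, dot w x <= N x) -> `|dot w x| <= C * `|x|.
Proof.
move=> wN; rewrite ler_norml lerNl -dotNr.
by rewrite (le_trans (wN _)) ?(is_normN hN)// (le_trans (wN _)).
Qed.

(* In the direction of a point of differentiability, a large sphere around a
   point of [A] looks like a hyperplane [dot w x = const]; the gaps thus thicken
   to slabs avoided by [A]. *)
Lemma avoided_slabs w M : smooth_functional N w ->
  exists2 c : int -> R, one_per_cell L c &
    forall k x, A x -> `|x| <= M -> eps / 4 <= `|dot w x - c k|.
Proof.
move=> [p [Np wp wN diff]].
have wC x := functional_norm_le x wN.
have [M0|M0] := ltP M 0.
  exists (fun k => k%:~R * L) => [k|k x _ xM].
    rewrite lexx intrD mulrDl mul1r ltrDl/= (lt_trans _ hL)//.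
    by rewrite !mulr_gt0.
  by move: (le_trans (normr_ge0 x) xM); rewrite leNgt M0.
have L0 : 0 < L by rewrite (lt_trans _ hL)// !mulr_gt0.
suff cell k : exists ck, k%:~R * L <= ck < (k + 1)%:~R * L /\
    forall x, A x -> `|x| <= M -> eps / 4 <= `|dot w x - ck|.
  have [c hc] := choice cell; exists c => [k|k x]; first by case: (hc k).
  by case: (hc k) => _; apply.
set a := k%:~R * L.
have kL : (k + 1)%:~R * L = a + L by rewrite intrD mulrDl mul1r.
(* Aim at the middle of the cell: [y] is known only up to [r], which moves its value under [w] by at
   most [C * r < L / 2]. *)
rewrite kL; set s := a + L / 2.
have e4 : 0 < eps / 4 by rewrite divr_gt0.
have [t0 ht0] := diff (`|s *: p| + r + M) (eps / 4) e4.
have [t tt0 tgap] := hgap t0.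
have [y [cy Ay]] := hA (t *: p + s *: p).
set y' : 'rV[R]_d := y - (t *: p + s *: p); have y'r : `|y'| <= r := cube_norm_le cy.
set b := dot w y'.
have wy : `|b| <= C * r by rewrite (le_trans (wC _))// ler_pM2l.
exists (s + b); split.
  move: wy hL; rewrite ler_norml /s => /andP[h1 h2] h3.
  by apply/andP; split; lra.
move=> x Ax xM; rewrite leNgt; apply/negP => close; apply: (tgap y x Ay Ax).
(* If [dot w x] is within [eps / 4] of [s + b], then [N (y - x)] is within [eps / 2] of [t]; the
   other [eps / 4] is the linearization error. *)
set v := s *: p + y' - x.
have -> : y - x = t *: p + v by apply/rowP => i; rewrite !mxE; ring.
have vM : `|v| <= `|s *: p| + r + M.
  rewrite (le_trans (ler_normB _ _))// lerD// (le_trans (ler_normD _ _))//.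
  by rewrite lerD2l.
have up := ht0 t v tt0 vM; have low := wN (t *: p + v).
have vb : dot w v = s + b - dot w x by rewrite dotBr dotDr dotZr wp mulr1.
move: low up close.
rewrite dotDr dotZr wp mulr1 vb ltr_norml.
move=> low up /andP[h1 h2].
by rewrite ltr_norml; apply/andP; split; lra.
Qed.

Lemma finitely_many_directions : exists n, forall w : 'I_n -> 'rV[R]_d,
  (forall i, smooth_functional N (w i)) ->
  ~ (forall i j, i != j -> gram (w i) (w j) != 0).
Proof.
(* A functional varies by less than [h] over a small cell of side [eta], and [2 * h = eps / 4] is
   the half-width of the slabs. *)
pose h := eps / 8; have h0 : 0 < h by rewrite divr_gt0.
have L0 : 0 < L by exact: lt_le_trans heL.
pose P := Num.truncn (C * r / h).
pose eta := r / P.+1%:R; have eta0 : 0 < eta by rewrite divr_gt0.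
have etah : C * eta < h.
  by rewrite /eta mulrA ltr_pdivrMr// -ltr_pdivrMl// mulrC truncnS_gt.
(* An offset in [[0, r]] divided by [eta] truncates to one of [0, ..., P.+1]; the last value occurs
   on the far face of the closed cube. *)
pose I := {ffun 'I_d -> 'I_P.+2}.
pose shift (a : I) : 'rV[R]_d := \row_i ((a i)%:R * eta).
pose dl2 := (h / L) ^+ 2; have dl20 : 0 < dl2 by rewrite exprn_gt0// divr_gt0.
pose n := (Num.truncn (8 * #|{: I}|%:R / dl2)).+1.
exists n => w sw gw.
(* For [i != j], [w i] kills [e (i, j)] and [w j] maps it to 1. Resampling the coordinate [(i, j)]
   of [om] thus moves [q om] along a progression of step [h] under [w j] and not at all under
   [w i]. *)
pose e (p : 'I_n * 'I_n) := (gram (w p.1) (w p.2))^-1 *: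
  (dot (w p.1) (w p.1) *: w p.2 - dot (w p.1) (w p.2) *: w p.1).
have e1 p : dot (w p.1) (e p) = 0.
  by rewrite /e dotZr dotBr !dotZr mulrC mulrBl; ring.
have e2 i j : i != j -> dot (w j) (e (i, j)) = 1.
  move=> /gw gij; rewrite /e /= dotZr dotBr !dotZr (dotC (w j) (w i)).
  by rewrite -expr2 -/(gram (w i) (w j)) mulVf.
pose q (om : {ffun 'I_n * 'I_n -> 'I_n}) := \sum_p ((om p)%:R * h) *: e p.
have q_upd om p k v : dot v (q (upd om p k)) =
    dot v (q om) - (om p)%:R * h * dot v (e p) + k%:R * h * dot v (e p).
  rewrite /q !dot_sumr (bigD1 p)//= [in RHS](bigD1 p)//= ffunE eqxx !dotZr.
  rewrite (eq_bigr (fun i => dot v (((om i)%:R * h) *: e i))) => [|i /negbTE ip].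
    by ring.
  by rewrite ffunE ip.
(* The bound covers the cubes at all corners [q om], so the slabs can be fixed before [om] is
   chosen. *)
pose M := \sum_om `|q om| + r.
have slabs i : exists c : int -> R, one_per_cell L c /\
    forall k x, A x -> `|x| <= M -> eps / 4 <= `|dot (w i) x - c k|.
  by have [c c1 c2] := avoided_slabs M (sw i); exists c.
have [c hc] := choice slabs.
pose x a i om := dot (w i) (q om + shift a).
have dec a : decoupled h (x a).
  move=> i j om ij; split=> [k|].
    by rewrite /x !dotDr q_upd (e1 (i, j)) !mulr0 subr0 addr0.
  exists (dot (w j) (q om) - (om (i, j))%:R * h + dot (w j) (shift a)) => k.
  by rewrite /x !dotDr q_upd e2// !mulr1; ring.
have cnt : 8 * #|{: I}|%:R < n%:R * (h / L) ^+ 2.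
  by rewrite -ltr_pdivrMr//; apply: truncnS_gt.
have [om hom] := stair_jumps_everywhere c h0 heL dec cnt.
have [y [cy Ay]] := hA (q om).
have yM : `|y| <= M.
  rewrite -[y](subrK (q om)) addrC (le_trans (ler_normD _ _))//.
  apply: lerD; last exact: cube_norm_le.
  by rewrite (bigD1 om)//= lerDl sumr_ge0.
pose a : I := [ffun i => inord (Num.truncn ((y 0 i - q om 0 i) / eta))].
set z : 'rV[R]_d := y - (q om + shift a).
have zeta : `|z| <= eta.
  apply: norm_le_coord => [|i]; first exact: ltW.
  have /andP[h1 h2] := cy i.
  have u0 : 0 <= (y 0 i - q om 0 i) / eta by rewrite divr_ge0 ?(ltW eta0)// subr_ge0.
  set u := (y 0 i - q om 0 i) / eta in u0 *.
  have uP : (Num.truncn u < P.+2)%N.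
    have /andP[tu _] := truncn_itv u0.
    rewrite ltnS -(ler_nat R) (le_trans tu)//.
    rewrite /u ler_pdivrMr// /eta mulrC divfK ?gt_eqF//.
    by rewrite lerBlDl.
  rewrite !mxE ffunE -/u inordK//.
  have /andP[t1 t2] := truncn_itv u0.
  rewrite /u ler_pdivlMr// in t1.
  rewrite /u ltr_pdivrMr// -natr1 mulrDl mul1r in t2.
  rewrite opprD addrA ger0_norm; lra.
(* The jump puts some [c i k] within [h] of the value of [w i] at the corner of the small cell of
   [y], hence within [2 * h] of [dot (w i) y]. *)
have [i /(stair_jump h0 heL)] := hom a.
have [ci avoid] := hc i.
move=> /(_ ci)[k /andP[k1 k2]].
have := avoid k y Ay yM; rewrite leNgt => /negP; apply.
have [p [_ _ wN _]] := sw i.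
set b := dot (w i) z; have bh : `|b| < h.
  by rewrite (le_lt_trans (functional_norm_le z wN))// (le_lt_trans _ etah)// ler_pM2l.
have -> : dot (w i) y = x a i om + b by rewrite -dotDr addrC subrK.
move: bh k1 k2; rewrite !ltr_norml /h => /andP[b1 b2] k1 k2.
by apply/andP; split; lra.
Qed.

End Separation.

Theorem corollary1 (R : realType) (d : nat) (hd : (2 <= d)%N)
    (L K : set 'rV[R]_d) (hL : well_distributed L)
    (hK : convex_body K) (hKs : symmetric0 K)
    (eps : R) (heps : 0 < eps)
    (hgaps : infinitely_many_gaps (distance_set K L) eps) :
  polytope K.
Proof.
have hN := Knorm_is_norm hK hKs.
have [_ _ [C C0 hC] _] := hN; have [r r0 hA] := hL.
have Cr : 0 < C * r by rewrite mulr_gt0.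
(* The cell length [2 * (C * r) + eps] meets both lower bounds required of it. *)
have period : 2 * (C * r) < 2 * (C * r) + eps by rewrite ltrDl.
have period8 : eps / 8 <= 2 * (C * r) + eps by lra.
have hgap (T : R) : exists2 t : R, T <= t &
    forall x y, L x -> L y -> ~ `|Knorm K (x - y) - t| < eps / 2.
  have [t Tt ht] := gaps_unbounded T heps hgaps; exists t => // x y Lx Ly lt.
  by apply: (ht _ lt); exists x, y.
have [n nn] := finitely_many_directions hN C0 hC r0 hA heps period period8 hgap.
have [[w [sw gw]]|[s ss sdom]] :=
  many_nonparallel_or_dominated (smooth_functional (Knorm K)) n.
  by case: (nn w sw gw).
apply: (dominated_polytope hN (Knorm_le1 hK hKs) ss) => w sw.
have [u us g0] := sdom w sw; exists u => //.
exact: gram0_dominated hN sw (ss u us) g0.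
Qed.
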